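(* Let $G$ be a finite simple undirected graph. (1) If $G$ is a complete graph, then $\mathcal{E}(G)=2\tau(G)$. (2) If $G$ is a bipartite graph, then $\mathcal{E}(G)\geq 2\tau(G)$. (3) If $G$ is a cycle, then $\mathcal{E}(G)\geq 2\tau(G)$.
   Context: All graphs are finite, simple and undirected. The energy $\mathcal{E}(G)$ is the sum of the absolute values of all eigenvalues (with multiplicity) of the adjacency matrix $A(G)$. The vertex cover number $\tau(G)$ is the minimum cardinality of a set $X\subseteq V(G)$ such that every edge of $G$ has at least one endpoint in $X$. *)

(* Defs.v *)
From mathcomp Require Import all_boot all_order all_algebra.

Set Implicit Arguments.
Unset Strict Implicit.
Unset Printing Implicit Defensive.

Import Order.TTheory GRing.Theory Num.Theory.

Local Open Scope ring_scope.

Record sgraph := SGraph {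
  vertex :> finType;
  adj : rel vertex;
  adj_sym : symmetric adj;
  adj_irrefl : irreflexive adj
}.

(* Rows and columns follow the enumeration [enum_val] of the vertices; another
   enumeration gives a permutation-similar matrix. *)
Definition adjmx (C : numClosedFieldType) (G : sgraph) : 'M[C]_#|G| :=
  \matrix_(i, j) (adj (enum_val i) (enum_val j))%:R.

(* Roots of the characteristic polynomial, each listed with its multiplicity;
   see [eigenvaluesP]. *)
Definition eigenvalues (C : numClosedFieldType) n (A : 'M[C]_n) : seq C :=
  sval (closed_field_poly_normal (char_poly A)).

Lemma eigenvaluesP (C : numClosedFieldType) n (A : 'M[C]_n) :
  char_poly A = \prod_(z <- eigenvalues A) ('X - z%:P).
Proof.
rewrite /eigenvalues; case: closed_field_poly_normal => r /= {1}->.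
by rewrite (monicP (char_poly_monic A)) scale1r.
Qed.

Definition energy (C : numClosedFieldType) (G : sgraph) : C :=
  \sum_(z <- eigenvalues (adjmx C G)) `|z|.

Definition vertex_cover (G : sgraph) (X : {set G}) : bool :=
  [forall x, forall y, adj x y ==> (x \in X) || (y \in X)].

(* [set: G] is a vertex cover, so the minimum is over a nonempty family; see
   [vertex_cover_numberP]. *)
Definition vertex_cover_number (G : sgraph) : nat :=
  #|[arg min_(X < [set: G] | vertex_cover X) #|X|]|.

Lemma vertex_cover_numberP (G : sgraph) :
  (exists2 X : {set G}, vertex_cover X & #|X| = vertex_cover_number G) /\
  (forall X : {set G}, vertex_cover X -> (vertex_cover_number G <= #|X|)%N).
Proof.
rewrite /vertex_cover_number; case: arg_minnP => [|X coverX minX].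
  by apply/forallP=> x; apply/forallP=> y; rewrite !inE implybT.
by split; first exists X.
Qed.

Definition complete_graph (G : sgraph) : Prop :=
  forall x y : G, x != y -> adj x y.

Definition bipartite_graph (G : sgraph) : Prop :=
  exists A : {set G}, forall x y : G, adj x y -> (x \in A) != (y \in A).

(* [ordS i] is i + 1 modulo n. *)
Definition cycle_graph (G : sgraph) : Prop :=
  exists n : nat, (3 <= n)%N /\
    exists f : 'I_n -> G, bijective f /\
      forall i j : 'I_n, adj (f i) (f j) = (j == ordS i) || (i == ordS j).

(* Main.v *)
(** Diagonalise the adjacency matrix in an orthonormal basis, so that the energy
    is [\sum_k |d_k|] with real [d_k].  For a complete graph the trace decides.
    For any graph the energy is at least twice the size of a matching, which by
    Koenig's theorem settles bipartite graphs, even cycles among them.  For an odd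
    cycle the cover number is at most [(n + 1) / 2]; if [n >= 7], bound [|d|]
    below by a combination of [d^2] and [d^4], whose sums are [2 n] and [6 n].
    The pentagon, where this is too weak, needs the finer information that its
    eigenvalues are [2] and the roots of [X^2 + X - 1]. *)
Require Import Defs.
From mathcomp Require Import all_boot all_order all_algebra.
From mathcomp Require Import ring zify.
Set Implicit Arguments.
Unset Strict Implicit.
Unset Printing Implicit Defensive.
Import Order.TTheory GRing.Theory Num.Theory.
Local Open Scope ring_scope.

(** * Spectral decomposition of the adjacency matrix *)

Lemma char_poly_conj (F : fieldType) n (P A : 'M[F]_n) :
  P \in unitmx -> char_poly (invmx P *m A *m P) = char_poly A.
Proof.
move=> Pu; rewrite /char_poly /char_poly_mx.
have PV1 : map_mx polyC (invmx P) *m map_mx polyC P = 1%:M.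
  by rewrite -map_mxM mulVmx // map_mx1.
have -> : 'X%:M - map_mx polyC (invmx P *m A *m P)
    = map_mx polyC (invmx P) *m ('X%:M - map_mx polyC A) *m map_mx polyC P.
  rewrite mulmxBr mulmxBl !map_mxM; congr (_ - _).
  by rewrite scalar_mxC -mulmxA PV1 mulmx1.
by rewrite !det_mulmx mulrAC -det_mulmx PV1 det1 mul1r.
Qed.

(** A real symmetric matrix is normal, hence unitarily diagonalisable; [u k] is row [k] of the
    unitary matrix. The fourth clause is column orthonormality, which lets matrix entries be
    expanded over eigenvectors. *)
Lemma adjmx_spectral (C : numClosedFieldType) (G : sgraph) :
  exists (d : 'I_#|G| -> C) (u : 'I_#|G| -> G -> C),
  [/\ energy C G = \sum_k `|d k|,
      forall k, d k \is Num.real,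
      forall k, \sum_x `|u k x| ^+ 2 = 1,
      forall x y, \sum_k u k x * (u k y)^* = (x == y)%:R
    & forall k x, \sum_(y | adj x y) u k y = d k * u k x].
Proof.
set A := adjmx C G.
have symA : A^T = A by apply/matrixP=> i j; rewrite !mxE adj_sym.
have hA : A \is hermsymmx.
  apply: realsym_hermsym.
    by apply/is_hermitianmxP; rewrite expr0 scale1r symA map_mx_id.
  by apply/mxOverP=> i j; rewrite mxE realn.
have nA := hermitian_normalmx hA; have /orthomx_spectralP := nA.
set P := spectralmx A; set d := spectral_diag A => defA.
have Pu : P \is unitarymx := spectral_unitarymx A.
have PU : P \in unitmx := unitarymx_unit Pu.
have PA : P *m A = diag_mx d *m P by rewrite {1}defA !mulmxA mulmxV // mul1mx.
exists (fun k => d 0 k), (fun k x => P k (enum_rank x)); split.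
(* Both lists are roots of the same product of monic linear factors, so they agree up to
   permutation. *)
- rewrite /energy (perm_big [seq d 0 i | i <- enum 'I_#|G|]) /=.
    by rewrite big_map big_enum.
  apply: prod_XsubC_eq; rewrite -eigenvaluesP -/A defA char_poly_conj //.
  rewrite char_poly_trig ?diag_mx_is_trig // big_map big_enum /=.
  by apply: eq_bigr => i _; rewrite mxE eqxx.
- by move=> k; have /mxOverP := hermitian_spectral_diag_real hA; apply.
- move=> k; have /unitarymxP /matrixP /(_ k k) := Pu.
  rewrite !mxE eqxx mulr1n => <-; rewrite (reindex enum_rank) /=.
    by apply: eq_bigr => x _; rewrite !mxE normCK.
  exact/onW_bij/enum_rank_bij.
- move=> x y; have := mulVmx PU; rewrite invmx_unitary // => /matrixP.
  move/(_ (enum_rank y) (enum_rank x)); rewrite !mxE (inj_eq enum_rank_inj) eq_sym.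
  by move<-; apply: eq_bigr => k _; rewrite !mxE mulrC.
- move=> k x; have /matrixP /(_ k (enum_rank x)) := PA.
  rewrite mul_diag_mx !mxE => <-; rewrite (reindex enum_rank) /=; last first.
    exact/onW_bij/enum_rank_bij.
  rewrite big_mkcond /=; apply: eq_bigr => y _.
  by rewrite mxE !enum_rankK adj_sym; case: adj; rewrite ?mulr1 ?mulr0.
Qed.

(** * Koenig's theorem *)

Section Koenig.

Variables S T : finType.
Implicit Types (H M : {set S * T}) (P : {set S}) (Q : {set T}).

Definition bicover H P Q := [forall e in H, (e.1 \in P) || (e.2 \in Q)].

Lemma bicoverP H P Q :
  reflect (forall e, e \in H -> (e.1 \in P) || (e.2 \in Q)) (bicover H P Q).
Proof. exact: (iffP forall_inP). Qed.

(* If two edges at a common left end were both critical, the intersection and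
   the union of the two small covers would give covers of [H] of total size at
   most [2 k - 1]. *)
Lemma bicover_uncross_l H k e f P1 Q1 P2 Q2 :
    (forall P Q, bicover H P Q -> k <= #|P| + #|Q|)%N ->
    e != f -> e.1 = f.1 -> e \in H -> f \in H ->
    bicover (H :\ e) P1 Q1 -> bicover (H :\ f) P2 Q2 ->
  (k <= #|P1| + #|Q1|)%N || (k <= #|P2| + #|Q2|)%N.
Proof.
move=> minH nef ef1 eH fH /bicoverP c1 /bicoverP c2.
(* A small cover containing the common left end also covers the deleted edge, hence all of [H]. *)
have [x1|x1] := boolP (e.1 \in P1).
  apply/orP; left; apply: minH; apply/bicoverP=> g gH.
  by have [->|neg] := eqVneq g e; [rewrite x1 | apply: c1; rewrite !inE neg].
have [x2|x2] := boolP (e.1 \in P2).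
  apply/orP; right; apply: minH; apply/bicoverP=> g gH.
  have [->|neg] := eqVneq g f; first by rewrite -ef1 x2.
  by apply: c2; rewrite !inE neg.
have f1 : f.2 \in Q1.
  by have := c1 f; rewrite !inE eq_sym nef fH -ef1 (negPf x1); apply.
have e2 : e.2 \in Q2 by have := c2 e; rewrite !inE nef eH (negPf x2); apply.
have cT : bicover H (P1 :&: P2) (Q1 :|: Q2).
  apply/bicoverP=> g gH; rewrite !inE.
  have [->|nge] := eqVneq g e; first by rewrite e2 !orbT.
  have [->|ngf] := eqVneq g f; first by rewrite f1 !orbT.
  have := c1 g; have := c2 g; rewrite !inE nge ngf gH => /(_ isT) + /(_ isT).
  by do 4!case: (_ \in _).
(* Adding the common left end covers [e] and [f] at the cost of one vertex, the only loss in the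
   count. *)
have cT' : bicover H (e.1 |: (P1 :|: P2)) (Q1 :&: Q2).
  apply/bicoverP=> g gH; rewrite !inE.
  have [->|nge] := eqVneq g e; first by rewrite eqxx.
  have [->|ngf] := eqVneq g f; first by rewrite -ef1 eqxx.
  have := c1 g; have := c2 g; rewrite !inE nge ngf gH => /(_ isT) + /(_ isT).
  by do 4!case: (_ \in _); rewrite ?orbT.
have := minH _ _ cT; have := minH _ _ cT'.
rewrite cardsU1 !inE negb_or x1 x2 /=.
have := cardsUI P1 P2; have := cardsUI Q1 Q2; lia.
Qed.

End Koenig.

(** Exchanging the two sides gives uncrossing at a common right end. *)
Definition swap_pairs (S T : finType) (H : {set S * T}) : {set T * S} :=
  [set (e.2, e.1) | e in H].

Lemma mem_swap_pairs (S T : finType) (H : {set S * T}) x y :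
  ((y, x) \in swap_pairs H) = ((x, y) \in H).
Proof.
apply/imsetP/idP=> [[[a b] abH [-> ->]] // | xyH]; by exists (x, y).
Qed.

Lemma bicover_swap (S T : finType) (H : {set S * T}) P Q :
  bicover (swap_pairs H) Q P = bicover H P Q.
Proof.
apply/bicoverP/bicoverP=> c [x y] xyH.
  by have := c (y, x); rewrite mem_swap_pairs orbC; apply.
by rewrite orbC; apply: (c (y, x)); rewrite -mem_swap_pairs.
Qed.

Lemma swap_pairsD1 (S T : finType) (H : {set S * T}) x y :
  swap_pairs (H :\ (x, y)) = swap_pairs H :\ (y, x).
Proof.
apply/setP=> -[a b]; rewrite mem_swap_pairs !inE mem_swap_pairs !xpair_eqE.
by rewrite [(b == x) && _]andbC.
Qed.

Theorem Koenig (S T : finType) (H : {set S * T}) k :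
    (forall P Q, bicover H P Q -> k <= #|P| + #|Q|)%N ->
  exists M : {set S * T}, [/\ M \subset H, (k <= #|M|)%N,
    {in M &, injective fst} & {in M &, injective snd}].
Proof.
have [m] := ubnP #|H|; elim: m => // m IH in H * => ltHm minH.
have rem e : e \in H -> [forall P, forall Q,
      bicover (H :\ e) P Q ==> (k <= #|P| + #|Q|)%N] ->
    exists M : {set S * T}, [/\ M \subset H, (k <= #|M|)%N,
    {in M &, injective fst} & {in M &, injective snd}].
  move=> eH minHe; have [|P Q cPQ|M [sM kM i1 i2]] := IH (H :\ e).
  - by move: ltHm; rewrite (cardsD1 e) eH.
  - by move/forallP: minHe => /(_ P) /forallP/(_ Q)/implyP; apply.
  - by exists M; split=> //; apply: subset_trans sM (subsetDl _ _).
have remN e : e \in H ->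
    (exists M : {set S * T}, [/\ M \subset H, (k <= #|M|)%N,
      {in M &, injective fst} & {in M &, injective snd}]) \/
    (exists P Q, bicover (H :\ e) P Q /\ (#|P| + #|Q| < k)%N).
  move=> eH; case: (boolP [forall P, _]) (rem e eH) => [_ /(_ isT)|]; first by left.
  rewrite negb_forall => /existsP[P]; rewrite negb_forall => /existsP[Q].
  by rewrite negb_imply -ltnNge => /andP[cPQ ltk] _; right; exists P, Q.
have [sh|] := boolP [exists e in H, exists f in H,
    (e != f) && ((e.1 == f.1) || (e.2 == f.2))].
  have /exists_inP[e eH /exists_inP[f fH /andP[nef sef]]] := sh.
  have [//|[P1 [Q1 [c1 lt1]]]] := remN e eH.
  have [//|[P2 [Q2 [c2 lt2]]]] := remN f fH.
  have [/eqP ef1|/eqP ef2] := orP sef.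
    by have := bicover_uncross_l minH nef ef1 eH fH c1 c2; lia.
  have minH' Q P : bicover (swap_pairs H) Q P -> (k <= #|Q| + #|P|)%N.
    by rewrite bicover_swap addnC; apply: minH.
  case: e f => x y [x' y'] /= in nef ef2 eH fH c1 c2 sh sef *.
  have := @bicover_uncross_l _ _ _ _ (y, x) (y', x') Q1 P1 Q2 P2 minH'.
  rewrite -!swap_pairsD1 !bicover_swap !mem_swap_pairs.
  have -> : (y, x) != (y', x') by move: nef; rewrite !xpair_eqE andbC.
  by move=> /(_ isT ef2 eH fH c1 c2); lia.
rewrite negb_exists_in => /forall_inP noshare.
have inj e f : e \in H -> f \in H -> (e.1 == f.1) || (e.2 == f.2) -> e = f.
  move=> eH fH sef; apply/eqP; have := noshare e eH.
  rewrite negb_exists_in => /forall_inP/(_ f fH).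
  by rewrite sef andbT negbK.
exists H; split=> //.
- have := minH [set e.1 | e in H] set0; rewrite cards0 addn0 => minH1.
  apply: leq_trans (minH1 _) (leq_imset_card _ _).
  by apply/bicoverP=> e eH; rewrite imset_f.
- by move=> e f eH fH ef; apply: inj => //; rewrite ef eqxx.
- by move=> e f eH fH ef; apply: inj => //; rewrite ef eqxx orbT.
Qed.

(** * Energy and matchings; bipartite graphs *)

(* Expanding [1 = adj x y] in the eigenbasis and applying AM-GM, each matching
   edge is paid for by the masses of its two ends. *)
Lemma energy_ge_matching (C : numClosedFieldType) (G : sgraph) (M : {set G * G}) :
    (forall e, e \in M -> adj e.1 e.2) ->
    {in M &, injective fst} -> {in M &, injective snd} ->
    (forall e f, e \in M -> f \in M -> e.1 != f.2) ->
  2%:R * #|M|%:R <= energy C G.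
Proof.
move=> adjM i1 i2 i12; have [d [u [-> _ u1 uu du]]] := adjmx_spectral C G.
have edge e : e \in M -> 2%:R <= \sum_k `|d k| * (`|u k e.1| ^+ 2 + `|u k e.2| ^+ 2).
  move=> eM; have -> : 2%:R = `|2%:R * (\sum_k d k * u k e.1 * (u k e.2)^*)| :> C.
    rewrite -[LHS](normr_nat C 2) -[LHS]mulr1 -[X in _ * X](normr_nat C 1) -normrM.
    congr `|_ * _|; under eq_bigr do rewrite -du mulr_suml.
    rewrite exchange_big /= (bigD1 e.2) ?adjM //= uu eqxx big1 ?addr0 // => y.
    by case/andP=> _ ney; rewrite uu (negPf ney).
  rewrite mulr_sumr; apply: le_trans (ler_norm_sum _ _ _) _.
  apply: ler_sum => k _; rewrite !normrM norm_conjC normr_nat.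
  rewrite -subr_ge0.
  rewrite [X in 0 <= X](_ : _ = `|d k| * (`|u k e.1| - `|u k e.2|) ^+ 2); last by ring.
  by rewrite mulr_ge0 // real_exprn_even_ge0 // rpredB // normr_real.
rewrite mulr_natr -sumr_const.
apply: le_trans (ler_sum _ (fun e eM => edge e eM)) _.
rewrite exchange_big /=; apply: ler_sum => k _; rewrite -mulr_sumr.
rewrite ler_piMr // big_split /= -(u1 k).
(* All ends of edges of [M] are distinct, so their masses sum to at most the unit mass of [u k]. *)
rewrite -(big_imset (fun x => `|u k x| ^+ 2) i1) -(big_imset (fun x => `|u k x| ^+ 2) i2) /=.
rewrite -bigU /=.
  by rewrite [leRHS](bigID [in [predU fst @: M & snd @: M]]) /= lerDl sumr_ge0 // => x _; rewrite exprn_ge0.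
rewrite disjoint_subset; apply/subsetP=> x /imsetP[e eM ->]; rewrite inE.
by apply/imsetP=> -[f fM /eqP]; apply/negP/i12.
Qed.

Lemma vertex_cover_number_le (G : sgraph) (X : {set G}) :
  (forall x y, adj x y -> (x \in X) || (y \in X)) ->
  (vertex_cover_number G <= #|X|)%N.
Proof.
move=> cX; apply: (vertex_cover_numberP G).2.
by apply/forallP=> x; apply/forallP=> y; apply/implyP/cX.
Qed.

(** Edges are oriented from [A] to its complement. The two sides of a cover of [H] unite to a vertex
    cover of [G], and no first end of an edge of [H] is a second end. *)
Lemma energy_bipartite (C : numClosedFieldType) (G : sgraph) :
  bipartite_graph G -> 2%:R * (vertex_cover_number G)%:R <= energy C G.
Proof.
case=> A bipA; pose H := [set e : G * G | adj e.1 e.2 && (e.1 \in A)].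
have [P Q cPQ|M [/subsetP sM kM i1 i2]] := @Koenig _ _ H (vertex_cover_number G).
  apply: leq_trans (vertex_cover_number_le (X := P :|: Q) _) _; last first.
    by rewrite -cardsUI leq_addr.
  move=> x y; wlog xA : x y / x \in A => [hw xy|xy].
    have [/hw|xA] := boolP (x \in A); first exact.
    have yA : y \in A by have := bipA _ _ xy; rewrite (negPf xA); case: (y \in A).
    by rewrite orbC hw // adj_sym.
  have /bicoverP/(_ (x, y)) := cPQ; rewrite !inE xy xA => /(_ isT) /=.
  by case/orP=> ->; rewrite ?orbT.
apply: le_trans (energy_ge_matching (M := M) C _ i1 i2 _).
- by rewrite ler_pM2l ?ltr0n // ler_nat.
- by move=> e /sM; rewrite inE => /andP[].
- move=> e f /sM + /sM; rewrite !inE => /andP[_ eA] /andP[/bipA + fA].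
  by rewrite fA; apply: contra_neq => <-; rewrite eA.
Qed.

(** * Traces and complete graphs *)

Lemma unit_vector_neq0 (C : numClosedFieldType) (I : finType) (v : I -> C) :
  \sum_i `|v i| ^+ 2 = 1 -> exists i, v i != 0.
Proof.
move=> v1; apply/existsP; apply: contraTT (oner_neq0 C) => /existsPn v0.
rewrite negbK -v1 big1 // => i _.
by have := v0 i; rewrite negbK => /eqP ->; rewrite normr0 expr0n.
Qed.

(** This is the trace formula: when [g k] is a power of the eigenvalue, each inner sum is a diagonal
    entry of that power of the matrix. *)
Lemma sum_eigenvalues (C : numClosedFieldType) (K I : finType) (g : K -> C)
    (v : K -> I -> C) : (forall k, \sum_i `|v k i| ^+ 2 = 1) ->
  \sum_k g k = \sum_i \sum_k (g k * v k i) * (v k i)^*.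
Proof.
move=> v1; rewrite exchange_big; apply: eq_bigr => k _ /=.
rewrite -[LHS]mulr1 -(v1 k) mulr_sumr; apply: eq_bigr => i _.
by rewrite normCK mulrA.
Qed.

Lemma vertex_cover_number_complete (G : sgraph) :
  complete_graph G -> vertex_cover_number G = #|G|.-1.
Proof.
move=> cG; apply/eqP; rewrite eqn_leq; apply/andP; split.
  have [x _|G0] := pickP [in G]; last first.
    by rewrite (leq_trans (vertex_cover_number_le (X := setT) _)) ?cardsT ?(eq_card0 G0) // => x; have := G0 x.
  rewrite -(cardsC1 x); apply: vertex_cover_number_le => y z yz.
  rewrite !inE -negb_and; apply: contraTN yz => /andP[/eqP-> /eqP->].
  by rewrite adj_irrefl.
have [[X /forallP cX <-] _] := vertex_cover_numberP G.
(* The complement of a cover is independent, so here it has at most one vertex. *)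
rewrite -(cardsC X); suff: (#|~: X| <= 1)%N by lia.
apply/card_le1_eqP=> x y; rewrite !inE => xX yX; apply/eqP; apply: contraNT xX => nxy.
by have /forallP/(_ x)/implyP/(_ (cG _ _ nxy)) := cX y; rewrite (negPf yX).
Qed.

(* Every eigenvalue [d] is [-1] or [n - 1], where [|d|] agrees with an affine
   function of [d]; hence the energy is determined by the trace, which is [0]. *)
Lemma energy_complete (C : numClosedFieldType) (G : sgraph) :
  complete_graph G -> energy C G = 2%:R * (vertex_cover_number G)%:R.
Proof.
move=> cG; rewrite vertex_cover_number_complete //.
have [d [u [-> _ u1 uu du]]] := adjmx_spectral C G.
have adjE (x y : G) : adj x y = (y != x).
  have [->|nyx] := eqVneq y x; first by rewrite adj_irrefl.
  by rewrite cG // eq_sym.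
have [n0|n_gt0] := posnP #|G|.
  by rewrite [X in X.-1]n0 mulr0 big1 // => k; have := ltn_ord k; rewrite [X in (_ < X)%N]n0.
pose m : C := #|G|.-1%:R; have mE : #|G|%:R = m + 1 by rewrite natr1 prednK.
have m0 : m + 1 != 0 by rewrite -mE pnatr_eq0 -lt0n.
have d_val k : d k = -1 \/ d k = m.
  pose S := \sum_x u k x.
  have eqd x : S - u k x = d k * u k x.
    rewrite -du /S (bigD1 x) //= addrAC subrr add0r.
    by apply: eq_bigl => y; rewrite adjE.
  (* Sum [eqd] over all vertices. *)
  have dS : d k * S = m * S.
    rewrite {1}/S mulr_sumr -(eq_bigr _ (fun x _ => eqd x)) sumrB sumr_const.
    by rewrite -[S *+ _]mulr_natl mE -/S mulrDl mul1r addrK.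
  have [/eqP S0|S_neq0] := boolP (S == 0); [left | right].
    have [x x0] := unit_vector_neq0 (u1 k); apply: (mulIf x0).
    by rewrite -eqd S0 sub0r mulN1r.
  exact: mulIf S_neq0 _ _ dS.
have d0 : \sum_k d k = 0.
  rewrite (sum_eigenvalues _ u1) big1 // => x _.
  under eq_bigr do rewrite -du mulr_suml.
  rewrite exchange_big big1 // => y; rewrite adjE => /negPf nyx.
  by rewrite uu nyx.
(* The affine function takes the value [1] at [-1] and [m] at [m]. *)
transitivity (\sum_k (m *+ 2 / (m + 1) + (m - 1) / (m + 1) * d k)).
  apply: eq_bigr => k _; case: (d_val k) => ->.
    by rewrite normrN1; field.
  by rewrite ger0_norm ?ler0n //; field.
rewrite big_split /= sumr_const card_ord -mulr_sumr d0 mulr0 addr0 -[_ *+ #|_|]mulr_natr mE.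
by rewrite mulfVK // mulr_natl.
Qed.

(** * Spectrum and moments of a cycle *)

Lemma val_iter_ordS n m (i : 'I_n) : iter m (@ordS n) i = ((i + m) %% n)%N :> nat.
Proof.
elim: m => [|m IH] /=; first by rewrite addn0 modn_small.
by rewrite IH addnS -(addn1 (_ %% _)) modnDml addn1.
Qed.

Lemma iter_ordS_eq n m (i : 'I_n) : (iter m (@ordS n) i == i) = (n %| m)%N.
Proof.
rewrite -val_eqE /= val_iter_ordS -{2}(modn_small (ltn_ord i)) -{2}[val i]addn0.
by rewrite eqn_modDl mod0n.
Qed.

(** Along [f] the eigenvalue equation becomes a three-term recurrence. Centring it at [ordS i]
    avoids predecessors. *)
Lemma cycle_spectral (C : numClosedFieldType) (G : sgraph) n (f : 'I_n -> G) :
    (3 <= n)%N -> bijective f ->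
    (forall i j, adj (f i) (f j) = (j == ordS i) || (i == ordS j)) ->
  exists (d : 'I_n -> C) (v : 'I_n -> 'I_n -> C),
  [/\ energy C G = \sum_k `|d k|,
      forall k, d k \is Num.real,
      forall k, \sum_i `|v k i| ^+ 2 = 1,
      forall i j, \sum_k v k i * (v k j)^* = (i == j)%:R
    & forall k i, v k (ordS (ordS i)) + v k i = d k * v k (ordS i)].
Proof.
move=> n3 bf adjf; have [d [u [-> dR u1 uu du]]] := adjmx_spectral C G.
have cardG : #|G| = n by rewrite -(bij_eq_card bf) card_ord.
case: _ / cardG in f bf n3 adjf *.
exists d, (fun k i => u k (f i)); split=> //.
- by move=> k; rewrite -(u1 k) (reindex f) //; apply: onW_bij.
- by move=> i j; rewrite uu (inj_eq (bij_inj bf)).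
move=> k i; rewrite -du (reindex f) /=; last exact: onW_bij.
under eq_bigl do rewrite adjf (inj_eq (@ordS_inj _)).
(* Since [n >= 3], the two neighbours of [ordS i] are distinct. *)
have ne : ordS (ordS i) != i by rewrite (iter_ordS_eq 2); apply/negP=> /dvdn_leq; lia.
rewrite (bigD1 (ordS (ordS i))) ?eqxx //= (bigD1 i) /=; last first.
  by rewrite eqxx orbT eq_sym.
rewrite big1 ?addr0 // => j /andP[/andP[]].
by rewrite [i == j]eq_sym => /orP[] /eqP->; rewrite eqxx ?andbF.
Qed.

Lemma iter_ordS_bij n m : bijective (iter m (@ordS n)).
Proof. by elim: m => [|m IH]; [exists id | apply: bij_comp (@ordS_bij n) IH]. Qed.

Section CycleMoments.

Variables (C : numClosedFieldType) (n : nat).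
Variables (d : 'I_n -> C) (v : 'I_n -> 'I_n -> C).
Hypothesis v1 : forall k, \sum_i `|v k i| ^+ 2 = 1.
Hypothesis vv : forall i j, \sum_k v k i * (v k j)^* = (i == j)%:R.
Hypothesis dv : forall k i, v k (ordS (ordS i)) + v k i = d k * v k (ordS i).

Local Notation w k m i := (v k (iter m (@ordS n) i)).

Lemma cycle_eigvecX m k i : d k * w k m.+1 i = w k m.+2 i + w k m i.
Proof. by rewrite -dv. Qed.

Lemma cycle_eigvecX2 k m i :
  d k ^+ 2 * w k m.+2 i = w k m.+4 i + 2%:R * w k m.+2 i + w k m i.
Proof. by rewrite expr2 -mulrA cycle_eigvecX mulrDr !cycle_eigvecX; ring. Qed.

Lemma sum_cycle_shift m (g : 'I_n -> C) :
  \sum_k g k = \sum_i \sum_k (g k * w k m i) * (w k m i)^*.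
Proof.
apply: (sum_eigenvalues _ (v := fun k i => w k m i)) => k.
have bij_iter : bijective (iter m (@ordS n)).
  by elim: m => [|m IH]; [exists id | apply: bij_comp (@ordS_bij n) IH].
rewrite -(v1 k) [RHS](reindex (iter m (@ordS n))) //; exact/onW_bij/iter_ordS_bij.
Qed.

Lemma cycle_orthoX a b i : (b <= a)%N ->
  \sum_k w k a i * (w k b i)^* = (n %| a - b)%:R.
Proof.
move=> ba; rewrite vv -{1}(subnK ba) addnC iterD.
by rewrite (inj_eq (bij_inj (iter_ordS_bij n b))) iter_ordS_eq.
Qed.

(** Each vertex has two closed walks of length two. The base point is moved two steps ahead so that
    walks only meet forward iterates of [ordS]. *)
Lemma cycle_sum_sq : (3 <= n)%N -> \sum_k d k ^+ 2 = 2%:R * n%:R.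
Proof.
move=> n3; rewrite (sum_cycle_shift 2).
have nd2 : (n %| 2)%N = false by apply/negP=> /dvdn_leq; lia.
transitivity (\sum_(i < n) 2%:R : C); last first.
  by rewrite sumr_const card_ord mulr_natr.
apply: eq_bigr => i _.
(* The conjugate puts the larger exponent first, as [cycle_orthoX] requires. *)
transitivity (\sum_k (w k 4 i * (w k 2 i)^* + 2%:R * (w k 2 i * (w k 2 i)^*)
   + (w k 2 i * (w k 0 i)^*)^*)).
  apply: eq_bigr => k _.
  rewrite cycle_eigvecX2 rmorphM /= conjCK; ring.
rewrite !big_split /= -mulr_sumr -rmorph_sum /=.
rewrite (cycle_orthoX (a := 4) (b := 2)) // (cycle_orthoX (a := 2) (b := 2)) //.
rewrite (cycle_orthoX (a := 2) (b := 0)) //.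
by rewrite subnn dvdn0 !nd2 conjC0 mulr1 addr0 add0r.
Qed.

(** For [n >= 5] a closed walk of length four cannot wind around the cycle, so the central binomial
    coefficient [6] counts those at each vertex. *)
Lemma cycle_sum_pow4 : (5 <= n)%N -> \sum_k d k ^+ 4 = 6%:R * n%:R.
Proof.
move=> n5; rewrite (sum_cycle_shift 4).
have nd2 : (n %| 2)%N = false by apply/negP=> /dvdn_leq; lia.
have nd4 : (n %| 4)%N = false by apply/negP=> /dvdn_leq; lia.
transitivity (\sum_(i < n) 6%:R : C); last first.
  by rewrite sumr_const card_ord mulr_natr.
apply: eq_bigr => i _.
transitivity (\sum_k (w k 8 i * (w k 4 i)^* + 4%:R * (w k 6 i * (w k 4 i)^*)
   + 6%:R * (w k 4 i * (w k 4 i)^*) + 4%:R * (w k 4 i * (w k 2 i)^*)^*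
   + (w k 4 i * (w k 0 i)^*)^*)).
  apply: eq_bigr => k _.
  have -> : d k ^+ 4 * w k 4 i = d k ^+ 2 * (d k ^+ 2 * w k 4 i) by ring.
  rewrite cycle_eigvecX2 !mulrDr [_ * (_ * _)]mulrCA !cycle_eigvecX2 !rmorphM /= !conjCK; ring.
rewrite !big_split /= -!mulr_sumr -!rmorph_sum /=.
rewrite (cycle_orthoX (a := 8) (b := 4)) // (cycle_orthoX (a := 6) (b := 4)) //.
rewrite (cycle_orthoX (a := 4) (b := 4)) // (cycle_orthoX (a := 4) (b := 2)) //.
rewrite (cycle_orthoX (a := 4) (b := 0)) // subnn dvdn0 !nd2 !nd4.
by rewrite conjC0 mulr1 !mulr0 !addr0 !add0r.
Qed.

End CycleMoments.

(** * Pointwise bounds on eigenvalues *)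

(* The quartic is tangent to [|x|] at [7/4], a rational close to the optimal
   [sqrt 3]. *)
Lemma abs_ge_quartic (C : numClosedFieldType) (x : C) : x \is Num.real ->
  6%:R / 7%:R * x ^+ 2 - 32%:R / 343%:R * x ^+ 4 <= `|x|.
Proof.
move=> xR; rewrite (exprM x 2 2) -(real_normK xR) -exprM -subr_ge0.
set t := `|x|; have t0 : 0 <= t by exact: normr_ge0.
(* After factoring out [t], the cubic has no square term; the double root [7/4] forces the third
   root [-7/2]. *)
have -> : t - (6%:R / 7%:R * t ^+ 2 - 32%:R / 343%:R * t ^+ 4)
  = 32%:R / 343%:R * (t * (t + 7%:R / 2%:R)) * (t - 7%:R / 4%:R) ^+ 2 by field.
apply: mulr_ge0.
  have t7 : 0 <= t + 7%:R / 2%:R by rewrite addr_ge0 ?divr_ge0 ?ler0n.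
  by apply: mulr_ge0; [rewrite divr_ge0 ?ler0n | apply: mulr_ge0].
by rewrite real_exprn_even_ge0 // rpredB ?ger0_real ?divr_ge0 ?ler0n.
Qed.

(* [|x| - 2/5 (1 + x^2) = - 2/5 (|x| - 2) (|x| - 1/2)], and the eigenvalues of
   the pentagon have absolute value between [1/2] and [2]. *)
Lemma abs_ge_quadratic (C : numClosedFieldType) (x : C) : x \is Num.real ->
  x = 2%:R \/ x ^+ 2 + x = 1 -> 2%:R / 5%:R * (1 + x ^+ 2) <= `|x|.
Proof.
move=> xR [-> | x2].
  rewrite normr_nat -subr_ge0.
  by rewrite [X in 0 <= X](_ : _ = 0 :> C) //; field.
rewrite -subr_ge0; have [x0|/ltW x0] := real_ge0P xR.
  (* Modulo [x^2 = 1 - x] the difference is linear with unclear sign. A suitable positive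
     multiplier, reduced again, makes it visibly nonnegative without computing square roots. *)
  have pos : 0 < x + 8%:R / 5%:R by rewrite ltr_wpDl // divr_gt0 ?ltr0n.
  rewrite -(pmulr_rge0 _ pos).
  have -> : (x + 8%:R / 5%:R) * (x - 2%:R / 5%:R * (1 + x ^+ 2))
     = 3%:R / 25%:R + x / 25%:R.
    have -> : x ^+ 2 = 1 - x by rewrite -x2 addrK.
    transitivity (7%:R / 5%:R * x ^+ 2 + 36%:R / 25%:R * x - 32%:R / 25%:R); first by field.
    have -> : x ^+ 2 = 1 - x by rewrite -x2 addrK.
    by field.
  by rewrite addr_ge0 ?divr_ge0 ?ler0n.
have pos : 0 < 1 / 2%:R - x by rewrite ltr_wpDr ?oppr_ge0 // divr_gt0 ?ltr0n.
rewrite -(pmulr_rge0 _ pos).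
have -> : (1 / 2%:R - x) * (- x - 2%:R / 5%:R * (1 + x ^+ 2))
   = 1 / 5%:R - x / 10%:R.
  have -> : x ^+ 2 = 1 - x by rewrite -x2 addrK.
  transitivity (3%:R / 5%:R * x ^+ 2 + 1 / 2%:R * x - 2%:R / 5%:R); first by field.
  have -> : x ^+ 2 = 1 - x by rewrite -x2 addrK.
  by field.
by rewrite subr_ge0 (le_trans (y := 0)) ?divr_ge0 ?ler0n ?mulr_le0_ge0 ?invr_ge0 ?ler0n.
Qed.

(** For the pentagon [A^2 + A - 1] is the all-ones matrix [J], and [(A - 2) J = 0]. Evaluating at a
    nonzero coordinate gives the alternative. *)
Lemma pentagon_eigenvalue (C : numClosedFieldType) (d : C) (v : 'I_5 -> C) :
    (forall i, v (ordS (ordS i)) + v i = d * v (ordS i)) ->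
    (exists i, v i != 0) ->
  d = 2%:R \/ d ^+ 2 + d = 1.
Proof.
move=> dv [i vi0]; pose w m := v (iter m (@ordS 5) i).
have w5 m : w m.+4.+1 = w m.
  by apply: (congr1 v); apply/eqP; rewrite (iter_ordS_eq 5 (iter m _ i)).
have dw m : d * w m.+1 = w m.+2 + w m by rewrite -dv.
have d0 : d * w 0 = w 1 + w 4 by rewrite -(w5 0) dw (w5 1).
have d4 : d * w 4 = w 0 + w 3 by rewrite dw (w5 0).
have dS : (d - 2%:R) * (w 0 + w 1 + w 2 + w 3 + w 4) = 0.
  rewrite mulrBl !mulrDr d0 d4 !dw; ring.
have eq0 : (d ^+ 2 + d - 1) * w 0 = w 0 + w 1 + w 2 + w 3 + w 4.
  rewrite mulrBl mulrDl expr2 -mulrA d0 mulrDr d4 dw; ring.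
move/eqP: dS; rewrite mulf_eq0 -eq0 mulf_eq0 subr_eq0 (negPf vi0) orbF.
by case/orP=> /eqP; [left | move/eqP; rewrite subr_eq0 => /eqP; right].
Qed.

(** * Covers and energy of cycles *)

Lemma sum_even_ord n : (\sum_(i < n) ~~ odd i)%N = uphalf n.
Proof.
elim: n => [|n IH]; first by rewrite big_ord0.
by rewrite big_ord_recr /= IH uphalf_half addnC addnA; case: (odd n); lia.
Qed.

(** The even positions form a cover: the successor of an odd position is even, also when it wraps
    around to [0]. *)
Lemma vertex_cover_number_cycle (G : sgraph) n (f : 'I_n -> G) :
    bijective f ->
    (forall i j, adj (f i) (f j) = (j == ordS i) || (i == ordS j)) ->
  (vertex_cover_number G <= uphalf n)%N.
Proof.
move=> bf adjf; rewrite -sum_even_ord.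
have [g fK gK] := bf.
apply: leq_trans (vertex_cover_number_le (X := [set f i | i : 'I_n & ~~ odd i]) _) _.
  have cov i : (f i \in [set f i | i : 'I_n & ~~ odd i]) = ~~ odd i.
    by rewrite mem_imset ?inE //; apply: bij_inj.
  move=> x y; rewrite -(gK x) -(gK y) adjf !cov.
  have odd_ordS (i : 'I_n) : odd i -> ~~ odd (ordS i).
    move=> oi /=; have := ltn_ord i; rewrite leq_eqVlt => /orP[/eqP->|ltn].
      by rewrite modnn.
    by rewrite modn_small //= oi.
  case/orP=> /eqP->; rewrite -implyNb negbK; apply/implyP; first exact: odd_ordS.
  by apply: contraTT => ?; apply: odd_ordS; rewrite -[odd _]negbK.
rewrite card_imset; last exact: bij_inj.
by rewrite -sum1_card big_mkcond /=; apply/eq_leq/eq_bigr => i _; rewrite inE; case: odd.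
Qed.

(** For odd [n], [n.+1] is twice the cover bound [uphalf n]. *)
Lemma energy_odd_cycle (C : numClosedFieldType) (G : sgraph) n (f : 'I_n -> G) :
    (5 <= n)%N -> odd n -> bijective f ->
    (forall i j, adj (f i) (f j) = (j == ordS i) || (i == ordS j)) ->
  n.+1%:R <= energy C G.
Proof.
move=> n5 on bf adjf; have n3 : (3 <= n)%N by lia.
have [d [v [-> dR v1 vv dv]]] := cycle_spectral C n3 bf adjf.
have sq := cycle_sum_sq v1 vv dv n3; have p4 := cycle_sum_pow4 v1 vv dv n5.
have [n5'|n7] := leqP n 6.
  have n5E : n = 5 by lia.
  subst n.
  apply: le_trans (ler_sum _ (fun k _ => abs_ge_quadratic (dR k)
    (pentagon_eigenvalue (dv k) (unit_vector_neq0 (v1 k))))).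
  (* The bound is [2/5 * (5 + 10) = 6], exactly [n + 1]. *)
  rewrite -mulr_sumr big_split /= sq sumr_const card_ord.
  by rewrite [leRHS](_ : _ = 6%:R) //; field.
apply: le_trans (ler_sum _ (fun k _ => abs_ge_quartic (dR k))).
rewrite sumrB -!mulr_sumr sq p4.
(* The inequality [343 (n + 1) <= 396 n] amounts to [343 <= 53 n], true from [n = 7] on. *)
rewrite [leRHS](_ : _ = (396 * n)%:R / 343%:R); last by rewrite natrM; field.
by rewrite ler_pdivlMr ?ltr0n // -natrM ler_nat; lia.
Qed.

Lemma bipartite_even_cycle (G : sgraph) n (f : 'I_n -> G) :
    ~~ odd n -> bijective f ->
    (forall i j, adj (f i) (f j) = (j == ordS i) || (i == ordS j)) ->
  bipartite_graph G.
Proof.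
move=> en [g fK gK] adjf; exists [set x | odd (g x)] => x y.
rewrite -(gK x) -(gK y) adjf !inE !fK.
have odd_ordS (i : 'I_n) : odd (ordS i) = ~~ odd i by rewrite /= odd_mod ?(negPf en).
by case/orP=> /eqP->; rewrite odd_ordS; case: odd.
Qed.

Lemma complete_triangle (G : sgraph) (f : 'I_3 -> G) :
    bijective f ->
    (forall i j, adj (f i) (f j) = (j == ordS i) || (i == ordS j)) ->
  complete_graph G.
Proof.
move=> [g fK gK] adjf x y; rewrite -(gK x) -(gK y) adjf (can_eq fK).
by move: (g x) (g y) => [[|[|[|//]]] ?] [[|[|[|//]]] ?].
Qed.

Theorem proposition3p1 (C : numClosedFieldType) (G : sgraph) :
  (complete_graph G -> energy C G = 2%:R * (vertex_cover_number G)%:R) /\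
  (bipartite_graph G -> energy C G >= 2%:R * (vertex_cover_number G)%:R) /\
  (cycle_graph G -> energy C G >= 2%:R * (vertex_cover_number G)%:R).
Proof.
split; first exact: energy_complete.
split; first exact: energy_bipartite.
case=> n [n3 [f [bf adjf]]].
have [on|en] := boolP (odd n); last exact/energy_bipartite/(bipartite_even_cycle en bf adjf).
have [n5|n4] := leqP 5 n.
  apply: le_trans (energy_odd_cycle C n5 on bf adjf).
  rewrite -natrM ler_nat; have := vertex_cover_number_cycle bf adjf; lia.
(* The remaining odd cycle is the triangle, which is complete. *)
have n3E : n = 3 by lia.
subst n.
by rewrite (energy_complete C (complete_triangle bf adjf)).
Qed.
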